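(* For every $\alpha\in\mathbb{R}$, the Fermat spiral $X=\{\sqrt{n}\,e^{2\pi i\alpha n} : n\in\mathbb{N}\}\subseteq\mathbb{C}\cong\mathbb{R}^2$ is not a dense forest.
   Context: A discrete set $X\subseteq\mathbb{R}^2$ is a dense forest if $\limsup_{r\to\infty}\#(B_r(0)\cap X)/r^2<\infty$ and there is a decreasing function $V\colon(0,\infty)\to(0,\infty)$ (a visibility function) such that for every $\epsilon>0$, every $\epsilon\times V(\epsilon)$ rectangle (in any position and orientation) intersects $X$. *)

(* Defs.v *)
From HB Require Import structures.
From mathcomp Require Import all_boot all_order all_algebra.
From mathcomp Require Import all_classical all_reals all_analysis.

Set Implicit Arguments.
Unset Strict Implicit.
Unset Printing Implicit Defensive.

Import Order.TTheory GRing.Theory Num.Theory.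
Import numFieldNormedType.Exports.

Local Open Scope classical_set_scope.
Local Open Scope ring_scope.

(* The library norm on R * R is the sup norm; it induces the usual topology,
   but balls and rectangles below are the Euclidean ones. *)
Definition euclidean_ball (R : realType) (r : R) : set (R * R) :=
  [set p | Num.sqrt (p.1 ^+ 2 + p.2 ^+ 2) < r].

(* The closed w x h rectangle with corner a, whose side of length w points in
   the direction (cos t, sin t) and whose side of length h points in the
   direction (- sin t, cos t). *)
Definition rectangle (R : realType) (a : R * R) (t w h : R) : set (R * R) :=
  [set p | exists x y : R,
     [/\ 0 <= x <= w, 0 <= y <= h
       & p = (a.1 + x * cos t - y * sin t, a.2 + x * sin t + y * cos t)]].

Definition discrete_set (R : realType) (X : set (R * R)) : Prop :=
  X `<=` isolated X.

(* counting takes the value +oo on infinite sets. *)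
Definition finite_upper_density (R : realType) (X : set (R * R)) : Prop :=
  (limf_esup
     (fun r : R => counting (euclidean_ball r `&` X) * (r ^- 2)%:E)
     (+oo%R : set_system R) < +oo)%E.

(* V stands for a function (0, oo) -> (0, oo); its values outside (0, oo) are
   irrelevant. *)
Definition visibility_function (R : realType) (X : set (R * R)) (V : R -> R)
    : Prop :=
  [/\ forall e, 0 < e -> 0 < V e,
      forall e1 e2, 0 < e1 -> e1 <= e2 -> V e2 <= V e1
    & forall e, 0 < e ->
        forall (a : R * R) (t : R), rectangle a t e (V e) `&` X !=set0].

Definition dense_forest (R : realType) (X : set (R * R)) : Prop :=
  [/\ discrete_set X, finite_upper_density X
    & exists V : R -> R, visibility_function X V].

(* The complex number sqrt n * e^(2 pi i alpha n), as (real part, imaginary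
   part). *)
Definition fermat_point (R : realType) (alpha : R) (n : nat) : R * R :=
  (Num.sqrt n%:R * cos (2 * pi * alpha * n%:R),
   Num.sqrt n%:R * sin (2 * pi * alpha * n%:R)).

Definition fermat_spiral (R : realType) (alpha : R) : set (R * R) :=
  range (fermat_point alpha).

(* Main.v *)
Require Import Defs.
From mathcomp Require Import all_boot all_order all_algebra.
From mathcomp Require Import all_classical all_reals all_analysis.
From mathcomp Require Import ring lra.

(** Far from the origin the spiral looks, in any bounded window, like a
    translate of a planar lattice of covolume pi.  A lattice leaves empty
    strips between consecutive lines parallel to one of its short vectors, and
    their width is bounded below independently of the lattice, so a fixed width
    forces arbitrarily long empty rectangles.

    The lines can be described without speaking of lattices.  Fix a large K.
    By Dirichlet there are integers 0 < q <= K and p such that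
    d = q alpha - p satisfies |d| <= 1 / K; the difference of two spiral points
    whose indices differ by q is the short vector.  The function
      F (z) = d |z|^2 - q arg z / (2 pi)
    takes integer values at the spiral points: at z = sqrt n e^(2 pi i alpha n)
    with arg z = 2 pi (alpha n - j) it equals q j - p n.  Near distance K from
    the origin, F has a gradient bounded independently of K, with radial part
    2 d K and tangential part - q / (2 pi K), and second derivatives of
    order 1 / K.  Its level curves there are therefore almost straight lines.
    Since q is nonzero, the direction theta can be chosen so that F takes the
    value 1/2 at the center K e^(i theta).  Then F stays strictly between 0
    and 1 on a rectangle of width 1/12 and prescribed length L whose long side
    follows the level line through the center, once K is large compared with
    L^2, and this rectangle contains no spiral point.

    [fermat_point_avoids_strip] is the linearization of F with explicit error
    terms, and [fermat_empty_rectangle] chooses K, theta and the direction of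
    the rectangle.  A visibility function V is refuted at the single width
    1/12, with L = V (1/12). *)

Set Implicit Arguments.
Unset Strict Implicit.
Unset Printing Implicit Defensive.

Import Order.TTheory GRing.Theory Num.Theory.
Import numFieldNormedType.Exports.

Local Open Scope ring_scope.

(** * Diophantine approximation *)

(** Pigeonhole: two of the N + 1 fractional parts of 0, alpha, ..., N alpha fall
    into the same one of the N boxes [k / N, (k + 1) / N). *)
Lemma dirichlet_approximation (R : realType) (alpha : R) (N : nat) :
  (0 < N)%N ->
  exists (q : nat) (p : int),
    [/\ (0 < q)%N, (q <= N)%N & `|q%:R * alpha - p%:~R| * N%:R <= 1].
Proof.
move=> N0; have N0R : 0 < N%:R :> R by rewrite ltr0n.
pose frac (i : nat) : R := i%:R * alpha - (Num.floor (i%:R * alpha))%:~R.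
have frac_itv i : 0 <= frac i < 1.
  have /andP[] := floor_itv (i%:R * alpha).
  by rewrite /frac intrD => *; apply/andP; split; lra.
have box_itv i : (Num.truncn (frac i * N%:R))%:R <= frac i * N%:R
                 < (Num.truncn (frac i * N%:R)).+1%:R.
  by apply: truncn_itv; rewrite mulr_ge0 ?ler0n//; case/andP: (frac_itv i).
have box_lt i : (Num.truncn (frac i * N%:R) < N)%N.
  have /andP[+ _] := box_itv i; have /andP[_] := frac_itv i.
  rewrite -(@ltr_nat R) => h1 h2; apply: le_lt_trans h2 _.
  by rewrite gtr_pMl.
pose box (i : 'I_N.+1) := Ordinal (box_lt i).
have /injectivePn[i0 [j0 ij0 eij0]] : ~~ injectiveb box.
  apply/negP => /injectiveP /leq_card.
  by rewrite !card_ord ltnn.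
have [i [j [ij eij]]] : exists i j : 'I_N.+1, (i < j)%N /\ box i = box j.
  case: (ltngtP i0 j0) => h; [by exists i0, j0|by exists j0, i0|].
  by move/eqP: ij0; case; apply: val_inj.
exists (j - i)%N, (Num.floor (j%:R * alpha) - Num.floor (i%:R * alpha)).
split; first by rewrite subn_gt0.
  by apply: leq_trans (leq_subr _ _) _; rewrite -ltnS.
have -> : (j - i)%:R * alpha
    - (Num.floor (j%:R * alpha) - Num.floor (i%:R * alpha))%:~R
    = frac j - frac i.
  by rewrite natrB ?(ltnW ij)// intrB /frac; ring.
rewrite -[N%:R]gtr0_norm// -normrM mulrBl ler_norml.
have := box_itv i; have := box_itv j.
move/(congr1 val): eij => /= ->; rewrite -[_.+1%:R]natr1.
by move=> /andP[? ?] /andP[? ?]; apply/andP; split; lra.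
Qed.

(** * Angles *)

Lemma sinB2pi_int (R : realType) (x : R) (j : int) :
  sin (x - 2 * pi * j%:~R) = sin x.
Proof.
case: j => n.
  rewrite -(periodicn (@sinD2pi R) n (x - _)); congr sin.
  by rewrite -mulr_natl -mulr_natr -pmulrn; ring.
rewrite -(periodicn (@sinD2pi R) n.+1 x); congr sin.
by rewrite NegzE mulrNz -pmulrn -mulr_natl -mulr_natr; ring.
Qed.

Lemma cosB2pi_int (R : realType) (x : R) (j : int) :
  cos (x - 2 * pi * j%:~R) = cos x.
Proof. by rewrite -!sinDpihalf addrAC sinB2pi_int. Qed.

Lemma angle_reduction (R : realType) (x : R) :
  exists j : int, `|x - 2 * pi * j%:~R| <= pi.
Proof.
have pi0 := @pi_gt0 R.
exists (Num.floor ((x + pi) / (2 * pi))).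
have /andP[] := floor_itv ((x + pi) / (2 * pi)).
rewrite intrD ler_pdivlMr ?mulr_gt0// ltr_pdivrMr ?mulr_gt0// => h1 h2.
by rewrite ler_norml; apply/andP; split; lra.
Qed.

(** By the mean value theorem sin x = x cos c for some c between 0 and x, and
    cos decreases on [0, pi].  For x < pi / 2 this is sin x <= x <= tan x. *)
Lemma sin_sandwich (R : realType) (x : R) :
  0 <= x <= pi -> x * cos x <= sin x <= x.
Proof.
move=> /andP[x0 xpi].
have [c] : exists2 c : R, c \in `[0, x] & sin x - sin 0 = cos c * (x - 0).
  apply: MVT_segment => //.
  by apply: continuous_subspaceT; exact: continuous_sin.
rewrite in_itv/= sin0 !subr0 => /andP[c0 cx] ->.
rewrite mulrC ler_wpM2r//=; last first.
  have [->//|cx'] := eqVneq c x.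
  apply/ltW; rewrite ltr_cos ?in_itv/= ?x0 ?xpi ?c0 ?(le_trans cx)//.
  by rewrite lt_neqAle cx'.
by rewrite -[leRHS]mul1r ler_wpM2r// cos_le1.
Qed.

(** For a point of polar coordinates (r, x) within M of (K, 0) in each Cartesian
    coordinate, the angle x is its height r sin x divided by K, up to an error
    of order 1 / K^2: [sin_sandwich] puts x between r sin x / r and
    r sin x / (r cos x), and both denominators are within 2 M of K. *)
Lemma arc_height_gap (R : realType) (K M r x : R) :
  0 < M -> 2 * M <= K -> 0 <= r -> `|x| <= pi ->
  `|r * cos x - K| <= M -> `|r * sin x| <= M ->
  K * `|K * x - r * sin x| <= 4 * M ^+ 2.
Proof.
move=> M0 MK r0.
wlog x0 : x / 0 <= x.
  move=> H; have [/H//|/ltW x0] := leP 0 x.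
  have := H (- x); rewrite oppr_ge0 cosN sinN !mulrN -opprD !normrN.
  exact.
rewrite (ger0_norm x0) => xpi.
have /andP[lo up] := @sin_sandwich R x (introT andP (conj x0 xpi)).
have s0 : 0 <= sin x by apply: sin_ge0_pi; rewrite x0.
rewrite ler_norml => /andP[u1 u2]; rewrite ger0_norm ?mulr_ge0// => w1.
have c1 := cos_le1 x; have cs := cos2Dsin2 x.
set c := cos x in lo u1 u2 c1 cs *; set s := sin x in lo up s0 w1 cs *.
have rK : r <= K + 2 * M.
  (* Euclidean norm below the sum of the coordinates *)
  rewrite -(@ler_pXn2r _ 2) ?nnegrE//; last by lra.
  have -> : r ^+ 2 = (r * c) ^+ 2 + (r * s) ^+ 2 by rewrite -[LHS]mulr1 -cs; ring.
  have : (r * c) ^+ 2 <= (K + M) ^+ 2 by rewrite ler_pXn2r ?nnegrE//; lra.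
  have : (r * s) ^+ 2 <= M ^+ 2 by rewrite ler_pXn2r ?nnegrE ?mulr_ge0//; lra.
  nra.
have rc : r * c <= r by rewrite ler_piMr.
have K0 : 0 < K by lra.
(* r cos x >= K - M >= K / 2 *)
have h1 : K <= 2 * (r * c) by lra.
have lo' : x * (r * c) <= r * s.
  by have := ler_wpM2l r0 lo; rewrite mulrCA.
have up' : r * s <= r * x by rewrite ler_wpM2l.
have xM : K * x <= 2 * M by have := ler_wpM2l x0 h1; lra.
rewrite -[K in K * `|_|]gtr0_norm// -normrM ler_norml; apply/andP; split.
  have : K * (r * s) <= K * (r * x) by rewrite ler_wpM2l// ltW.
  have : (r - K) * (K * x) <= (2 * M) * (K * x).
    by rewrite ler_wpM2r ?mulr_ge0//; lra.
  have : 2 * M * (K * x) <= 2 * M * (2 * M) by rewrite ler_wpM2l//; lra.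
  nra.
have : K * (K * x - r * s) <= K * (M * x).
  rewrite ler_wpM2l ?(ltW K0)//.
  have : (K - M) * x <= (r * c) * x by rewrite ler_wpM2r//; lra.
  lra.
have : M * (K * x) <= M * (2 * M) by rewrite ler_wpM2l//; lra.
nra.
Qed.

(** * Empty rectangles along the spiral *)

(** In the frame rotated by theta, a spiral point (K + u, w) near (K, 0) has
    F = 1/2 + l + errors, where l is the linear form in (u, w) inside the norm
    below.  As F is an integer there, |l| is at least 1/2 minus the errors: at
    most 2 M^2 / K from d (u^2 + w^2), and at most M^2 / K from replacing the
    polar angle by w / K.  The inequality is multiplied through by K. *)
Lemma fermat_point_avoids_strip (R : realType) (alpha theta K M u w : R)
    (n q : nat) (p : int) :
  0 < M -> 2 * M <= K -> (0 < q)%N -> q%:R <= K ->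
  `|q%:R * alpha - p%:~R| * K <= 1 ->
  (q%:R * alpha - p%:~R) * K ^+ 2 - q%:R * theta / (2 * pi) = 1 / 2 ->
  `|u| <= M -> `|w| <= M ->
  Num.sqrt n%:R * cos (2 * pi * alpha * n%:R - theta) = K + u ->
  Num.sqrt n%:R * sin (2 * pi * alpha * n%:R - theta) = w ->
  K / 2 <= K * `|2 * (q%:R * alpha - p%:~R) * K * u - q%:R * w / (2 * pi * K)|
           + 3 * M ^+ 2.
Proof.
move=> M0 MK q0 qK; set d := q%:R * alpha - p%:~R => dK dtheta uM wM.
have [j] := angle_reduction (2 * pi * alpha * n%:R - theta).
rewrite -(cosB2pi_int _ j) -(sinB2pi_int _ j).
set x := _ - _ - _ => xpi ecos esin.
have pi2 := @pi_ge2 R; have pi0 := @pi_gt0 R.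
have K0 : 0 < K by lra.
have gap : K * `|K * x - w| <= 4 * M ^+ 2.
  rewrite -esin; apply: arc_height_gap => //; last by rewrite esin.
  by rewrite ecos addrAC subrr add0r.
have en : n%:R = (K + u) ^+ 2 + w ^+ 2 :> R.
  rewrite -ecos -esin !exprMn sqr_sqrtr ?ler0n// -mulrDr cos2Dsin2 mulr1//.
(* I is the value of F: x is the angle reduced by j turns. *)
pose I : int := q%:Z * j - p * n%:Z.
set l := 2 * d * K * u - _.
have eI : I%:~R - 1 / 2 = l + d * (u ^+ 2 + w ^+ 2)
     - q%:R / (2 * pi) * ((K * x - w) / K) :> R.
  have -> : I%:~R = q%:R * j%:~R - p%:~R * n%:R :> R.
    by rewrite /I intrB !intrM -!pmulrn.
  have -> : q%:R * j%:~R - p%:~R * n%:R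
     = d * n%:R - q%:R * theta / (2 * pi) - q%:R / (2 * pi) * x :> R.
    rewrite /d /x; move: (@pi R) pi0 => P P0.
    by field; rewrite gt_eqF.
  rewrite -dtheta en /l; move: (@pi R) pi0 => P P0.
  by field; rewrite !gt_eqF.
have I12 : 1 / 2 <= `|I%:~R - 1 / 2 : R|.
  have [I0|I1] := leP I 0.
    have : I%:~R <= 0 :> R by rewrite -[0]/(0%:~R) ler_int.
    by move=> ?; rewrite ler0_norm; lra.
  have : 1 <= I%:~R :> R by rewrite -[1]/(1%:~R) ler_int.
  by move=> ?; rewrite ger0_norm; lra.
have quad : K * `|d * (u ^+ 2 + w ^+ 2)| <= 2 * M ^+ 2.
  have h0 : 0 <= u ^+ 2 + w ^+ 2 by rewrite addr_ge0 ?sqr_ge0.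
  rewrite normrM (ger0_norm h0) mulrA [K * _]mulrC.
  have hu : u ^+ 2 <= M ^+ 2 by rewrite -real_normK ?num_real// ler_pXn2r ?nnegrE// ltW.
  have hw : w ^+ 2 <= M ^+ 2 by rewrite -real_normK ?num_real// ler_pXn2r ?nnegrE// ltW.
  apply: le_trans (_ : 1 * (u ^+ 2 + w ^+ 2) <= _); last by lra.
  by rewrite ler_wpM2r.
have angular : K * `|q%:R / (2 * pi) * ((K * x - w) / K)| <= M ^+ 2.
  rewrite normrM [`|_ / K|]normrM normfV (gtr0_norm K0).
  have -> : `|q%:R / (2 * pi)| = q%:R / (2 * pi) :> R.
    by rewrite ger0_norm// divr_ge0// mulr_ge0// ltW.
  have -> : K * (q%:R / (2 * pi) * (`|K * x - w| / K))
     = q%:R * `|K * x - w| / (2 * pi).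
    by move: (@pi R) pi0 => P P0; field; rewrite !gt_eqF.
  rewrite ler_pdivrMr ?mulr_gt0//.
  apply: le_trans (_ : 4 * M ^+ 2 <= _).
    by apply: le_trans gap; rewrite ler_wpM2r.
  rewrite mulrC ler_wpM2l ?sqr_ge0//; lra.
have : K * (1 / 2) <= K * `|I%:~R - 1 / 2 : R| by rewrite ler_wpM2l// ltW.
have : K * `|I%:~R - 1 / 2 : R| <= K * (`|l| + `|d * (u ^+ 2 + w ^+ 2)|
     + `|q%:R / (2 * pi) * ((K * x - w) / K)|).
  rewrite ler_wpM2l ?(ltW K0)// eI.
  by apply: le_trans (ler_normB _ _) _; rewrite lerD2r ler_normD.
lra.
Qed.

(** The vector (- sin t, cos t) spans the kernel of the linear form (a, b). *)
Lemma level_direction (R : realType) (a b : R) :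
  exists t, a * sin t = b * cos t.
Proof.
have [->|a0] := eqVneq a 0.
  by exists (pi / 2); rewrite cos_pihalf mul0r mulr0.
exists (atan (b / a)).
have c0 : cos (atan (b / a)) != 0.
  by rewrite gt_eqF// cos_gt0_pihalf// atan_gtNpi2 atan_ltpi2.
have := atanK (b / a); rewrite /tan => /(congr1 (fun z => z * a * cos (atan (b/a)))).
rewrite (divfK a0) => <-; by field.
Qed.

Lemma fermat_empty_rectangle (R : realType) (alpha L : R) :
  0 < L -> exists (a : R * R) (t : R),
    ~ (rectangle a t (1 / 12) L `&` fermat_spiral alpha !=set0)%classic.
Proof.
move=> L0; pose M : R := 1 / 12 + L.
have M0 : 0 < M by rewrite /M; lra.
(* All points of the rectangle are within M of its corner, and the total error
   3 M^2 / K must stay below 1/4. *)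
pose N := Num.truncn (12 * M ^+ 2 + 2 * M).
pose K : R := N.+1%:R.
have KM : 12 * M ^+ 2 + 2 * M < K by apply: truncnS_gt.
have M2 : 0 < M ^+ 2 by rewrite exprn_gt0.
have K0 : 0 < K by rewrite ltr0n.
have [q [p [q0 qN dK]]] := @dirichlet_approximation R alpha N.+1 isT.
rewrite -/K in dK; set d := _ - p%:~R in dK.
have pi2 := @pi_ge2 R; have pi0 := @pi_gt0 R.
have qR : 0 < q%:R :> R by rewrite ltr0n.
have qK : q%:R <= K by rewrite ler_nat.
(* This makes F equal to 1/2 at K e^(i theta). *)
pose theta : R := 2 * pi * (d * K ^+ 2 - 1 / 2) / q%:R.
pose b : R := - (q%:R / (2 * pi * K)).
have [t abt] := @level_direction R (2 * d * K) b.
exists (K * cos theta, K * sin theta), (t + theta).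
case=> z [[x [y [/andP[x0 x1] /andP[y0 yL] ->]]] [n _]] /=.
rewrite /fermat_point => -[e1 e2].
set psi := 2 * pi * alpha * n%:R in e1 e2.
pose u := x * cos t - y * sin t; pose w := x * sin t + y * cos t.
have cs := cos2Dsin2 theta.
have bound s c : `|s| <= 1 -> `|c| <= 1 -> `|x * s| + `|y * c| <= M.
  move=> s1 c1; rewrite !normrM (ger0_norm x0) (ger0_norm y0).
  have := ler_wpM2l x0 s1; have := ler_wpM2l y0 c1.
  by rewrite /M !mulr1; lra.
have uM : `|u| <= M.
  by apply: le_trans (ler_normB _ _) (bound _ _ _ _); rewrite ?cos_max ?sin_max.
have wM : `|w| <= M.
  by apply: le_trans (ler_normD _ _) (bound _ _ _ _); rewrite ?cos_max ?sin_max.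
have ecos : Num.sqrt n%:R * cos (psi - theta) = K + u.
  rewrite cosB mulrDr !mulrA e1 e2 cosD sinD.
  transitivity ((K + u) * (cos theta ^+ 2 + sin theta ^+ 2)); last by rewrite cs mulr1.
  by rewrite /u; ring.
have esin : Num.sqrt n%:R * sin (psi - theta) = w.
  rewrite sinB mulrBr !mulrA e1 e2 cosD sinD.
  transitivity (w * (cos theta ^+ 2 + sin theta ^+ 2)); last by rewrite cs mulr1.
  by rewrite /w; ring.
have dtheta : d * K ^+ 2 - q%:R * theta / (2 * pi) = 1 / 2.
  rewrite /theta; move: (@pi R) pi0 => P P0.
  by field; rewrite !gt_eqF.
have MK : 2 * M <= K by lra.
have := fermat_point_avoids_strip M0 MK q0 qK dK dtheta uM wM ecos esin.
rewrite -/d.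
(* The long side lies in the kernel of the linear part: y disappears. *)
have -> : 2 * d * K * u - q%:R * w / (2 * pi * K)
        = x * (2 * d * K * cos t + b * sin t).
  transitivity (2 * d * K * u + b * w).
    rewrite /b; move: (@pi R) pi0 => P P0.
    by field; rewrite !gt_eqF.
  have : y * (2 * d * K * sin t) = y * (b * cos t) by rewrite abt.
  by rewrite /u /w => h; lra.
(* The gradient is at most 2 + 1, so over the width 1/12 the linear part varies
   by at most 1/4. *)
have a2 : `|2 * d * K| <= 2.
  by rewrite !normrM (gtr0_norm K0) -mulrA ger0_norm//; lra.
have b1 : `|b| <= 1.
  rewrite /b normrN ger0_norm ?divr_ge0 ?mulr_ge0 ?(ltW K0) ?(ltW pi0) ?(ltW qR)//.
  rewrite ler_pdivrMr ?mulr_gt0// mul1r (le_trans qK)// ler_peMl ?(ltW K0)//.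
  lra.
have grad : `|2 * d * K * cos t + b * sin t| <= 3.
  apply: le_trans (ler_normD _ _) _.
  rewrite [`|_ * cos t|]normrM [`|b * _|]normrM.
  have : `|2 * d * K| * `|cos t| <= 2 * 1 by rewrite ler_pM// cos_max.
  have : `|b| * `|sin t| <= 1 * 1 by rewrite ler_pM// sin_max.
  lra.
rewrite normrM (ger0_norm x0).
have : K * (x * `|2 * d * K * cos t + b * sin t|) <= K * (1 / 12 * 3).
  by rewrite ler_wpM2l ?(ltW K0)// ler_pM.
lra.
Qed.

Theorem corollary7 (R : realType) (alpha : R) :
  ~ dense_forest (fermat_spiral alpha).
Proof.
move=> [_ _ [V [V0 _ hV]]].
have e0 : 0 < 1 / 12 :> R by lra.
have [a [t]] := fermat_empty_rectangle alpha (V0 _ e0).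
by apply; exact: hV.
Qed.
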